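(* Let $X=\{X_t\}_{t\ge 0}$ be a Markov chain on $(\mathsf X,\mathscr X)$ with transition kernel $Q$ which is $\psi$-irreducible, aperiodic and positive Harris recurrent, $\pi$-reversible for a probability measure $\pi$, and geometrically ergodic, and let $g:\mathsf X\to\mathbb R$ satisfy $\int g(x)^2\pi(dx)<\infty$. Let $\gamma(k)=\mathrm{Cov}_\pi(g(X_0),g(X_{|k|}))$, $k\in\mathbb Z$, and let $F$ be the representing measure for $\gamma$, i.e. the measure supported in $[-1,1]$ with $\gamma(k)=\int x^{|k|}F(dx)$ for all $k\in\mathbb Z$. Suppose $\delta\in(0,1]$ is chosen so that $F$ is supported on $[-1+\delta,1-\delta]$. Let $r_M$ be an initial autocovariance sequence estimator satisfying conditions (R.1)–(R.3) of the context, and let $\hat\mu_{\delta,M}$ be the representing measure for $\Pi_\delta(r_M)$. Then for each initial condition $x\in\mathsf X$, $$P_x\big(\hat\mu_{\delta,M}\to F\ \text{vaguely, as } M\to\infty\big)=1.$$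
   Context: **Markov chain.** $\mathsf X$ is a complete separable metric space with Borel $\sigma$-algebra $\mathscr X$. $P_\nu$ (resp. $P_x$) is the law on the canonical sequence space of the chain with kernel $Q$ and initial distribution $\nu$ (resp. started at $x$); $\mathrm{Cov}_\pi$ is covariance under $P_\pi$. $Q$ is $\pi$-reversible if $\int f_1\,(Qf_2)\,d\pi=\int (Qf_1)\,f_2\,d\pi$ for all $f_1,f_2\in L^2(\pi)$, where $Qf(x)=\int Q(x,dy)f(y)$. Geometric ergodicity: there are $\rho<1$ and a non-negative (finite) function $V$ on $\mathsf X$ with $\|Q^n(x,\cdot)-\pi\|_{\mathrm{TV}}\le V(x)\rho^n$ for all $x\in\mathsf X$ and all $n$. $\psi$-irreducibility, aperiodicity and positive Harris recurrence are in the sense of Meyn and Tweedie. **Moment sequences.** $\ell_2(\mathbb Z)$ is the space of square-summable real sequences on $\mathbb Z$, with norm $\|\cdot\|$. $\mathscr M_\infty(\delta)$ is the set of $m\in\mathbb R^{\mathbb Z}$ for which there is a positive measure $\mu$ (the representing measure of $m$, which is unique) supported on $[-1+\delta,1-\delta]$ with $m(k)=\int x^{|k|}\mu(dx)$ for all $k\in\mathbb Z$ (convention $0^0=1$). For $r\in\ell_2(\mathbb Z)$, $\Pi_\delta(r)=\arg\min_{m\in\mathscr M_\infty(\delta)\cap\ell_2(\mathbb Z)}\|r-m\|^2$ (it exists and is unique). **Vague convergence.** Measures $\nu_n$ on $\mathbb R$ converge vaguely to $\nu$ if $\int f\,d\nu_n\to\int f\,d\nu$ for all $f\in C_0(\mathbb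 R)$, the continuous functions vanishing at infinity. **Conditions on the initial estimator.** For each $M$, $r_M=\{r_M(k)\}_{k\in\mathbb Z}$ is a real sequence computed from $X_0,\dots,X_{M-1}$ such that: (R.1) for each $k\in\mathbb Z$, $r_M(k)\to\gamma(k)$ as $M\to\infty$, $P_x$-a.s., for any $x\in\mathsf X$; (R.2) $r_M(k)=0$ for $k\ge n(M)$, for some $n(M)<\infty$; (R.3) $r_M(k)=r_M(-k)$ and $r_M(0)\ge |r_M(k)|$ for each $k\in\mathbb Z$. *)

(* Defs.v *)
From HB Require Import structures.
From mathcomp Require Import all_boot all_order all_algebra.
From mathcomp Require Import all_classical all_reals all_analysis.

Set Implicit Arguments.
Unset Strict Implicit.
Unset Printing Implicit Defensive.

Import Order.TTheory GRing.Theory Num.Theory.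
Import numFieldNormedType.Exports.

Local Open Scope classical_set_scope.
Local Open Scope ring_scope.
Local Open Scope ereal_scope.

#[short(type="completeMetricType")]
HB.structure Definition CompleteMetric (R : numDomainType) :=
  { T of Metric R T & Complete T }.

Definition separable (T : topologicalType) : Prop :=
  exists2 D : set T, countable D & dense D.

Notation borel X := (g_sigma_algebraType (@open X)).

Section path_space.
Context d (T : measurableType d).

Definition coordinate_events : set_system (nat -> T) :=
  \bigcup_n preimage_set_system setT (fun w : nat -> T => w n) measurable.

End path_space.

Notation path_space T := (g_sigma_algebraType (@coordinate_events _ T)).

Section markov_chain.
Context d (T : measurableType d) (R : realType).
Variable Q : R.-pker T ~> T.

(* cylinder_prob [:: A_1; ...; A_n] x is the probability, starting from x, that
   the next n states lie in A_1, ..., A_n respectively *)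
Fixpoint cylinder_prob (s : seq (set T)) (x : T) : \bar R :=
  if s is A :: s' then \int[Q x]_(y in A) cylinder_prob s' y else 1.

(* P is the law of the chain with kernel Q and initial distribution nu; it is
   determined by the probabilities of the measurable rectangles *)
Definition is_chain_law (nu : probability T R)
    (P : probability (path_space T) R) : Prop :=
  forall (A : set T) (s : seq (set T)), measurable A ->
    (forall i, (i < size s)%N -> measurable (nth setT s i)) ->
    P [set w | A (w 0%N) /\
               forall i, (i < size s)%N -> nth setT s i (w i.+1)] =
    \int[nu]_(x in A) cylinder_prob s x.

Fixpoint kernel_iter (n : nat) (x : T) (A : set T) : \bar R :=
  if n is n'.+1 then \int[Q x]_y kernel_iter n' y A else \d_x A.

Definition kernel_op (f : T -> R) (x : T) : \bar R := \int[Q x]_y (f y)%:E.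

Definition reversible (pi : probability T R) : Prop :=
  forall f1 f2 : T -> R, f1 \in Lfun pi 2%:E -> f2 \in Lfun pi 2%:E ->
    \int[pi]_x ((f1 x)%:E * kernel_op f2 x) =
    \int[pi]_x (kernel_op f1 x * (f2 x)%:E).

Definition invariant (pi : probability T R) : Prop :=
  forall A, measurable A -> \int[pi]_x Q x A = pi A.

Definition tv_dist (mu nu : set T -> \bar R) : \bar R :=
  ereal_sup [set `|mu A - nu A| | A in measurable].

Definition geometrically_ergodic (pi : probability T R) : Prop :=
  exists (rho : R) (V : T -> R),
    [/\ (rho < 1)%R, forall x, (0 <= V x)%R &
        forall x n, tv_dist (kernel_iter n x) pi <= (V x * rho ^+ n)%:E].

(* P nu is meant to be the law of the chain with initial distribution nu, as
   in is_chain_law. The definitions below follow Meyn and Tweedie, Markov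
   Chains and Stochastic Stability. *)
Variable P : probability T R -> probability (path_space T) R.

(* L(x, A) in Meyn and Tweedie: time 0 does not count *)
Definition hitting_prob (x : T) (A : set T) : \bar R :=
  P \d_x [set w | exists2 n, (0 < n)%N & A (w n)].

Definition irreducibility_measure
    (phi : {sigma_finite_measure set T -> \bar R}) : Prop :=
  0 < phi setT /\
  forall A, measurable A -> 0 < phi A -> forall x, 0 < hitting_prob x A.

(* psi must be a maximal irreducibility measure: it dominates all the others *)
Definition psi_irreducible
    (psi : {sigma_finite_measure set T -> \bar R}) : Prop :=
  irreducibility_measure psi /\
  forall phi : {sigma_finite_measure set T -> \bar R},
    irreducibility_measure phi ->
    forall A, measurable A -> psi A = 0 -> phi A = 0.

(* the p-cycles of Meyn and Tweedie; the period is the length of a longest one *)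
Definition cyclic_decomposition
    (psi : set T -> \bar R) (p : nat) (D : nat -> set T) : Prop :=
  [/\ (0 < p)%N,
      (forall i, (i < p)%N -> measurable (D i)),
      trivIset `I_p D,
      (forall i x, (i < p)%N -> D i x -> Q x (D (i.+1 %% p)%N) = 1) &
      psi (~` \bigcup_(i in `I_p) D i) = 0].

Definition is_period (psi : set T -> \bar R) (p : nat) : Prop :=
  (exists D, cyclic_decomposition psi p D) /\
  forall p' D, cyclic_decomposition psi p' D -> (p' <= p)%N.

Definition aperiodic (psi : set T -> \bar R) : Prop := is_period psi 1.

Definition harris_recurrent
    (psi : {sigma_finite_measure set T -> \bar R}) : Prop :=
  psi_irreducible psi /\
  forall A, measurable A -> 0 < psi A -> forall x, A x ->
    P \d_x [set w | forall N, exists2 n, (N <= n)%N & A (w n)] = 1.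

Definition positive_harris_recurrent
    (psi : {sigma_finite_measure set T -> \bar R}) : Prop :=
  harris_recurrent psi /\ exists pi : probability T R, invariant pi.

Definition autocovariance (pi : probability T R) (g : T -> R) (k : int) : R :=
  fine (covariance (P pi) (fun w => g (w 0%N)) (fun w => g (w `|k|%N))).

End markov_chain.

Section moment_sequences.
Context (R : realType).
Implicit Types (m r : int -> R) (mu : {measure set R -> \bar R}) (delta : R).

(* the case k = 0 forces mu to be finite, as x ^+ 0 = 1 also at x = 0 *)
Definition representing_measure (S : set R) mu m : Prop :=
  mu (~` S) = 0 /\ forall k, \int[mu]_x (x ^+ `|k|%N)%:E = (m k)%:E.

Definition moment_support delta : set R := `[(-1 + delta)%R, (1 - delta)%R].

Definition moment_sequence delta m : Prop :=
  exists mu, representing_measure (moment_support delta) mu m.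

Definition l2_sqnorm m : \bar R := \esum_(k in [set: int]) (m k ^+ 2)%:E.

(* m attains the minimum over M_oo(delta) `&` l2; the minimizer is unique *)
Definition is_moment_projection delta r m : Prop :=
  [/\ moment_sequence delta m, l2_sqnorm m < +oo &
      forall m', moment_sequence delta m' -> l2_sqnorm m' < +oo ->
        l2_sqnorm (r \- m)%R <= l2_sqnorm (r \- m')%R].

Definition vague_cvg (nu : nat -> {measure set R -> \bar R}) mu : Prop :=
  forall f : R -> R, continuous f ->
    f x @[x --> +oo%R] --> (0 : R)%R -> f x @[x --> -oo%R] --> (0 : R)%R ->
    \int[nu n]_x (f x)%:E @[n --> \oo] --> \int[mu]_x (f x)%:E.

End moment_sequences.

Section estimator.
Context (T : Type) (R : realType).

(* An estimator r sends a sample s of size M, here X_0, ..., X_(M - 1), to the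
   sequence r M s. *)
Definition sample (M : nat) (w : nat -> T) : 'I_M -> T := fun i => w i.

Definition finite_lag_estimator
    (r : forall M : nat, ('I_M -> T) -> int -> R) : Prop :=
  forall M, exists n : nat, forall s (k : int), (n%:Z <= k)%R -> r M s k = 0%R.

Definition symmetric_peaked_estimator
    (r : forall M : nat, ('I_M -> T) -> int -> R) : Prop :=
  forall M s k, r M s k = r M s (- k)%R /\ (`|r M s k| <= r M s 0)%R.

End estimator.

Definition consistent_estimator d (T : measurableType d) (R : realType)
    (P : probability T R -> probability (path_space T) R)
    (gamma : int -> R)
    (r : forall M : nat, ('I_M -> T) -> int -> R) : Prop :=
  forall k x, {ae P \d_x, forall w : path_space T,
    r M (sample (M := M) w) k @[M --> \oo] --> gamma k}.

(* Main.v *)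
Require Import Defs.
From HB Require Import structures.
From mathcomp Require Import all_boot all_order all_algebra.
From mathcomp Require Import all_classical all_reals all_analysis.
From mathcomp Require Import measurable_realfun ring lra.

Import Order.TTheory GRing.Theory Num.Theory.
Import numFieldNormedType.Exports.

Local Open Scope classical_set_scope.
Local Open Scope ring_scope.

(* On the almost sure event where r_M(k) -> gamma(k) for every k, the argument
   is deterministic. Let m_M be the projection of r_M. Its first-order
   optimality in the direction of gamma gives <r_M - m_M, gamma - m_M> <= 0, so
     |gamma - m_M|^2 <= <gamma - r_M, gamma - m_M>.
   As |m(k)| <= (1 - delta)^|k| m(0) for every moment sequence m, the right-hand
   side is at most
     (gamma(0) + m_M(0)) * sum_k |r_M(k) - gamma(k)| (1 - delta)^|k|,
   where the sum tends to 0 by dominated convergence, r_M being bounded by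
   r_M(0). This first bounds m_M(0) and then gives m_M(k) -> gamma(k).
   Convergence of the moments on a compact interval implies vague convergence by
   the Weierstrass approximation theorem. *)

(** * Weierstrass approximation by Bernstein polynomials *)

Section bernstein.
Context {R : realType}.
Implicit Types (h : nat -> R) (x c : R).

(* bernstein n h x = \sum_(k <= n) h k * 'C(n, k) * x ^+ k * (1 - x) ^+ (n - k);
   Pascal's recursion turns the facts below into inductions without binomials *)
Fixpoint bernstein n h x : R :=
  if n is n'.+1
  then x * bernstein n' (fun k => h k.+1) x + (1 - x) * bernstein n' h x
  else h 0%N.

Lemma bernstein_poly n h : exists p : {poly R}, forall x, p.[x] = bernstein n h x.
Proof.
elim: n h => [|n IH] h; first by exists (h 0%N)%:P => x; rewrite hornerC.
have [p pE] := IH h; have [q qE] := IH (fun k => h k.+1).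
by exists ('X * q + (1 - 'X) * p) => x; rewrite !hornerE pE qE.
Qed.

Lemma le_bernstein n h1 h2 x : 0 <= x <= 1 ->
  (forall k, (k <= n)%N -> h1 k <= h2 k) -> bernstein n h1 x <= bernstein n h2 x.
Proof.
move=> x01; elim: n h1 h2 => [|n IH] h1 h2 h12 /=; first exact: h12.
apply: lerD; apply: ler_wpM2l; rewrite ?subr_ge0; try by case/andP: x01.
- by apply: IH => k kn; exact: h12.
- by apply: IH => k kn; apply: h12; exact: leqW.
Qed.

(** The second moment about [c] of a binomial(n, x) variable: variance plus squared bias. Keeping
    [c] general lets the induction absorb the shift to [k.+1] as a move of the centre to [c - 1]. *)
Lemma bernstein_sqr n c x :
  bernstein n (fun k => (k%:R - c) ^+ 2) x = n%:R * x * (1 - x) + (n%:R * x - c) ^+ 2.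
Proof.
elim: n c => [|n IH] c /=; first by ring.
have -> : bernstein n (fun k => (k.+1%:R - c) ^+ 2) x =
    bernstein n (fun k => (k%:R - (c - 1)) ^+ 2) x.
  by congr bernstein; apply/funext => k; rewrite -natr1; ring.
by rewrite !IH -natr1; ring.
Qed.

Lemma bernstein_affine n h a b x :
  bernstein n (fun k => a * h k + b) x = a * bernstein n h x + b.
Proof. by elim: n h => [|n IH] h //=; rewrite !IH; ring. Qed.

End bernstein.

(** Heine-Cantor, from the near-covering form of compactness: a modulus [d] tending to 0 from the
    right works locally around each point of the segment, hence uniformly. Only [x] has to lie in
    the segment. *)
Lemma segment_unif_continuous {R : realType} (f : R -> R) (a b : R) (e : R) :
  continuous f -> 0 < e ->
  exists2 d, 0 < d & forall x y, a <= x <= b -> `|x - y| < d -> `|f x - f y| <= e.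
Proof.
move=> cf e0.
pose P (d y : R) := forall z, `|y - z| < d -> `|f y - f z| <= e.
have /(_ R 0^'+ P) := (compact_near_coveringP `[a, b]).1 (@segment_compact _ a b).
case.
  move=> x _.
  have /cvgrPdist_lt/(_ (e / 2)) := cf x.
  rewrite divr_gt0// => /(_ isT) /nbhs_ballP[d /= d0 dP].
  (* With half radii, both [y] and any [z] within [t] of [y] stay within [d] of [x], so each of
     [f y], [f z] is within [e / 2] of [f x]. *)
  exists (ball x (d / 2), [set t | t < d / 2]).
    split => /=; first by apply: nbhsx_ballx; rewrite divr_gt0.
    by apply: nbhs_right_lt; rewrite divr_gt0.
  move=> [y t] [/= xy td] z yz.
  have yd : `|x - y| < d / 2 := xy.
  have /dP yd' : ball x d y by rewrite /ball /=; lra.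
  have /dP zd' : ball x d z.
    rewrite /ball /= (_ : x - z = (x - y) + (y - z)); last by ring.
    by rewrite (le_lt_trans (ler_normD _ _))//; lra.
  rewrite (_ : f y - f z = (f x - f z) - (f x - f y)); last by ring.
  by rewrite (le_trans (ler_normB _ _))//; move: yd' zd'=> /=; lra.
move=> d /= d0 dP.
exists (d / 2); first by rewrite divr_gt0.
move=> x y xab xy.
apply: (dP (d / 2)) => //=.
- by rewrite sub0r normrN ger0_norm; lra.
- by rewrite divr_gt0.
Qed.

Lemma segment_bounded {R : realType} (f : R -> R) (a b : R) : continuous f ->
  exists2 B, 0 <= B & forall x, a <= x <= b -> `|f x| <= B.
Proof.
move=> cf; have [M [_ Mf]] : bounded_set (f @` `[a, b]).
  apply: compact_bounded; apply: continuous_compact; last exact: segment_compact.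
  exact: continuous_subspaceT.
exists (`|M| + 1) => [|x xab]; first by rewrite addr_ge0.
by apply: (Mf (`|M| + 1)); [rewrite ltr_pwDr// ler_norm|exists x].
Qed.

(** Bernstein's argument: bound the oscillation of [f] by [e / 2] plus a quadratic, then average
    over the binomial law, whose variance makes the quadratic part at most A x (1 - x) / n. *)
Lemma weierstrass01 {R : realType} (f : R -> R) (e : R) : continuous f -> 0 < e ->
  exists p : {poly R}, forall x, 0 <= x <= 1 -> `|f x - p.[x]| <= e.
Proof.
move=> cf e0.
have [d d0 fd] := @segment_unif_continuous _ f 0 1 (e / 2) cf ltac:(lra).
have [B B0 fB] := @segment_bounded _ f 0 1 cf.
(* When |x - y| >= d, the trivial bound 2B on the oscillation is at most A (x - y)^2. *)
pose A := 2 * B / d ^+ 2.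
have A0 : 0 <= A by apply: divr_ge0; [exact: mulr_ge0|exact: sqr_ge0].
have fA x y : 0 <= x <= 1 -> 0 <= y <= 1 -> `|f x - f y| <= e / 2 + A * (x - y) ^+ 2.
  move=> x01 y01; have [xy|xy] := ltP `|x - y| d.
    by rewrite (le_trans (fd _ _ x01 xy))// lerDl mulr_ge0// sqr_ge0.
  rewrite (le_trans (ler_normB _ _))// (le_trans (lerD (fB _ x01) (fB _ y01)))//.
  apply: ler_wpDl; first by rewrite divr_ge0// ltW.
  rewrite -[X in X <= _]mulr1 /A (_ : 2 * B / d ^+ 2 * (x - y) ^+ 2
    = (B + B) * ((x - y) ^+ 2 / d ^+ 2)); last by field; rewrite gt_eqF.
  rewrite ler_wpM2l ?addr_ge0// ler_pdivlMr ?exprn_gt0// mul1r.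
  by rewrite -(real_normK (num_real (x - y))) lerXn2r ?nnegrE // ltW.
pose n := (Num.trunc (A / e)).+1.
have n0 : 0 < n%:R :> R by rewrite ltr0n.
have An : A / n%:R <= e.
  rewrite ler_pdivrMr// mulrC -ler_pdivrMr//.
  by rewrite ltW// /n; apply: truncnS_gt.
have [p pE] := bernstein_poly n (fun k => f (k%:R / n%:R)).
exists p => x x01; rewrite pE.
have key k : (k <= n)%N -> `|f x - f (k%:R / n%:R)| <=
    A / n%:R ^+ 2 * (k%:R - n%:R * x) ^+ 2 + e / 2.
  move=> kn; rewrite (le_trans (fA _ _ x01 _))//.
    by rewrite divr_ge0//= ler_pdivrMr// mul1r ler_nat.
  rewrite addrC lerD2r le_eqVlt; apply/orP; left; apply/eqP.
  by field; rewrite gt_eqF.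
(* Centred at the mean n x, only the variance n x (1 - x) remains; A / n <= e and x (1 - x) <= 1/2
   give the other [e / 2]. *)
have bd : A / n%:R ^+ 2 * bernstein n (fun k => (k%:R - n%:R * x) ^+ 2) x + e / 2 <= e.
  rewrite bernstein_sqr subrr expr0n addr0.
  have -> : A / n%:R ^+ 2 * (n%:R * x * (1 - x)) = A / n%:R * (x * (1 - x)).
    by field; rewrite gt_eqF.
  have x4 : x * (1 - x) <= 1 / 2 by nra.
  have xx : 0 <= x * (1 - x) by nra.
  have : A / n%:R * (x * (1 - x)) <= e * (1 / 2).
    by apply: ler_pM => //; rewrite divr_ge0.
  by lra.
rewrite -bernstein_affine in bd.
(* Each side of the absolute value comes from monotonicity of [bernstein], applied to f(k/n) - f(x)
   and to its opposite. *)
rewrite ler_norml; apply/andP; split.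
- have : bernstein n (fun k => 1 * f (k%:R / n%:R) + - f x) x <= e.
    apply: le_trans bd; apply: le_bernstein => // k kn.
    by have := key k kn; rewrite ler_norml => /andP[+ _]; lra.
  by rewrite bernstein_affine; lra.
- have : bernstein n (fun k => -1 * f (k%:R / n%:R) + f x) x <= e.
    apply: le_trans bd; apply: le_bernstein => // k kn.
    by have := key k kn; rewrite ler_norml => /andP[_]; lra.
  by rewrite bernstein_affine; lra.
Qed.

Lemma weierstrass {R : realType} (f : R -> R) (a b e : R) :
  a < b -> continuous f -> 0 < e ->
  exists p : {poly R}, forall x, a <= x <= b -> `|f x - p.[x]| <= e.
Proof.
move=> ab cf e0; have ba0 : 0 < b - a by rewrite subr_gt0.
have cg : continuous (fun t : R => f (a + (b - a) * t)).
  move=> t; apply: continuous_comp; last exact: cf.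
  by apply: cvgD; [exact: cvg_cst|apply: cvgM; [exact: cvg_cst|exact: cvg_id]].
have [p pP] := @weierstrass01 _ _ e cg e0.
exists (p \Po ((b - a)^-1 *: ('X - a%:P))) => x /andP[ax xb].
have := pP ((b - a)^-1 * (x - a)); rewrite horner_comp hornerZ hornerXsubC.
rewrite mulrA mulfV ?gt_eqF// mul1r (addrC a) subrK; apply.
apply/andP; split; first by rewrite mulr_ge0 ?invr_ge0 ?(ltW ba0)// subr_ge0.
by rewrite mulrC ler_pdivrMr// mul1r lerB.
Qed.

(** * Partial sums over the integers and the squared l2 norm *)

Section int_sums.
Set Implicit Arguments.
Unset Strict Implicit.
Context {R : realType}.
Implicit Types (u v w a b m r : int -> R) (n : nat).

(* the window is [-n, n), as Negz i is - i.+1 *)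
Definition sumZ n u : R := \sum_(0 <= i < n) (u (Posz i) + u (Negz i)).

Lemma sumZD n u v : sumZ n (u \+ v) = sumZ n u + sumZ n v.
Proof. by rewrite /sumZ -big_split; apply: eq_bigr => i _ /=; ring. Qed.

Lemma sumZM n c u : sumZ n (fun k => c * u k) = c * sumZ n u.
Proof. by rewrite /sumZ big_distrr; apply: eq_bigr => i _ /=; ring. Qed.

Lemma eq_sumZ n u v : u =1 v -> sumZ n u = sumZ n v.
Proof. by move=> uv; apply: eq_bigr => i _; rewrite !uv. Qed.

Lemma le_sumZ n u v : (forall k, u k <= v k) -> sumZ n u <= sumZ n v.
Proof. by move=> uv; apply: ler_sum => i _; exact: lerD. Qed.

Lemma cvg_sumZ (T : Type) (F : set_system T) (FF : Filter F)
    (f : T -> int -> R) u n :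
  (forall k, f t k @[t --> F] --> u k) -> sumZ n (f t) @[t --> F] --> sumZ n u.
Proof.
move=> fu; elim: n => [|n IH].
  by rewrite /sumZ big_geq//; under eq_fun do rewrite big_geq//; exact: cvg_cst.
rewrite /sumZ big_nat_recr//=; under eq_fun do rewrite big_nat_recr//=.
by apply: cvgD => //; exact: cvgD.
Qed.

Lemma nondecreasing_sumZ u : (forall k, 0 <= u k) -> nondecreasing_seq (sumZ ^~ u).
Proof.
move=> u0; apply: (@nondecreasing_series _ _ predT 0) => i _ _.
by rewrite addr_ge0.
Qed.

(** The integers split into the images of [Posz] and [Negz], both injective, so the unordered sum
    becomes two series over the naturals, added term by term. *)
Lemma l2_cvge m :
  (sumZ n (fun k => m k ^+ 2))%:E @[n --> \oo] --> l2_sqnorm m.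
Proof.
have m0 k : (0 <= (m k ^+ 2)%:E)%E by rewrite lee_fin sqr_ge0.
rewrite /l2_sqnorm (esumID (range Posz))//.
have -> : [set: int] `&` range Posz = Posz @` setT by rewrite setTI.
have -> : [set: int] `&` ~` range Posz = Negz @` setT.
  rewrite setTI; apply/seteqP; split => [[] i /=|_ [i _ <-] [j _]]//.
    by case; exists i.
  by move=> _; exists i.
rewrite !esum_image; [|by move=> ? ? _ _ []..].
rewrite -!nneseries_esumT// -nneseriesD//.
rewrite (_ : (fun n => _) = fun n =>
  (\sum_(0 <= i < n) ((m (Posz i) ^+ 2)%:E + (m (Negz i) ^+ 2)%:E))%E).
  by apply: is_cvg_nneseries => i _ _; exact: adde_ge0.
by apply/funext => n; rewrite -sumEFin.
Qed.

Lemma l2_fin_num m : (l2_sqnorm m < +oo)%E -> l2_sqnorm m \is a fin_num.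
Proof.
by move=> moo; rewrite ge0_fin_numE// esum_ge0// => k _; rewrite lee_fin sqr_ge0.
Qed.

Lemma sqr_le_l2 m k : ((m k ^+ 2)%:E <= l2_sqnorm m)%E.
Proof.
apply: esum_ge; exists [set k]; first by split.
by rewrite fsbig_set1.
Qed.

Lemma l2_cvg m : (l2_sqnorm m < +oo)%E ->
  sumZ n (fun k => m k ^+ 2) @[n --> \oo] --> fine (l2_sqnorm m).
Proof.
move=> moo; apply: (fine_cvg (f := fun n => (sumZ n (fun k => m k ^+ 2))%:E)).
by rewrite fineK ?l2_fin_num//; exact: l2_cvge.
Qed.

Lemma l2_le m C : (forall n, sumZ n (fun k => m k ^+ 2) <= C) ->
  (l2_sqnorm m <= C%:E)%E.
Proof.
move=> mC; rewrite -(cvg_lim _ (@l2_cvge m))//.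
apply: lime_le; first by apply: cvgP; exact: l2_cvge.
by apply: nearW => n; rewrite lee_fin.
Qed.

Lemma sumZ_le_l2 m n : ((sumZ n (fun k => m k ^+ 2))%:E <= l2_sqnorm m)%E.
Proof.
rewrite -(cvg_lim _ (@l2_cvge m))//.
apply: lime_ge; first by apply: cvgP; exact: l2_cvge.
exists n => // p /= np; rewrite lee_fin; apply: nondecreasing_sumZ np => k.
exact: sqr_ge0.
Qed.

Lemma finite_lag_l2 u N : (forall k, (N <= `|k|)%N -> u k = 0) -> (l2_sqnorm u < +oo)%E.
Proof.
move=> u0; apply: le_lt_trans (ltry (sumZ N (fun k => u k ^+ 2))).
apply: l2_le => n; have [nN|/ltnW Nn] := leP n N.
  by apply: nondecreasing_sumZ nN => k; exact: sqr_ge0.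
rewrite /sumZ (@big_cat_nat _ _ _ N 0 n)//= -[leRHS]addr0 lerD2l big_nat big1// => i.
by case/andP => Ni _; rewrite !u0 ?expr0n ?addr0//= ltnW.
Qed.

Lemma l2B u v : (l2_sqnorm u < +oo)%E -> (l2_sqnorm v < +oo)%E ->
  (l2_sqnorm (u \- v)%R < +oo)%E.
Proof.
move=> uoo voo.
apply: le_lt_trans (ltry (2 * fine (l2_sqnorm u) + 2 * fine (l2_sqnorm v))).
apply: l2_le => n.
apply: (@le_trans _ _ (2 * sumZ n (fun k => u k ^+ 2) +
    2 * sumZ n (fun k => v k ^+ 2))).
  rewrite -!sumZM -sumZD; apply: le_sumZ => k /=.
  have := sqr_ge0 (u k + v k); nra.
by apply: lerD; rewrite ler_pM2l// -lee_fin fineK ?sumZ_le_l2 ?l2_fin_num.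
Qed.

Lemma l2Z c u : (l2_sqnorm u < +oo)%E -> (l2_sqnorm (fun k => (c * u k)%R) < +oo)%E.
Proof.
move=> uoo; apply: le_lt_trans (ltry (c ^+ 2 * fine (l2_sqnorm u))).
apply: l2_le => n; under eq_sumZ do rewrite exprMn.
by rewrite sumZM ler_wpM2l ?sqr_ge0// -lee_fin fineK ?sumZ_le_l2 ?l2_fin_num.
Qed.

(* The first-order optimality condition <a, b> <= 0 together with
   |b|^2 = <a, b> + <b - a, b>. *)
Lemma l2_first_order a b E : (l2_sqnorm a < +oo)%E -> (l2_sqnorm b < +oo)%E ->
  (forall t, 0 < t <= 1 -> (l2_sqnorm a <= l2_sqnorm (a \- (fun k => t * b k))%R)%E) ->
  (forall n, sumZ n (fun k => (b k - a k) * b k) <= E) ->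
  (l2_sqnorm b <= E%:E)%E.
Proof.
move=> aoo boo amin bE.
have doo := l2B aoo boo.
have [ac bc dc] := And3 (l2_cvg aoo) (l2_cvg boo) (l2_cvg doo).
set A := fine _ in ac; set B := fine _ in bc; set D := fine _ in dc.
(* Polarization: the inner product converges because the three squared norms do. *)
have abE n : sumZ n (fun k => a k * b k) = 2^-1 * (sumZ n (fun k => a k ^+ 2) +
    sumZ n (fun k => b k ^+ 2) - sumZ n (fun k => (a \- b) k ^+ 2)).
  rewrite -[X in _ = 2^-1 * (_ + X)]mulN1r -!sumZM -!sumZD -sumZM.
  by apply: eq_sumZ => k /=; field.
have abc : sumZ n (fun k => a k * b k) @[n --> \oo] --> 2^-1 * (A + B - D).
  under eq_fun do rewrite abE.
  by apply: cvgM; [exact: cvg_cst|apply: cvgB => //; exact: cvgD].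
set C := 2^-1 * _ in abc.
(* Expand |a - t b|^2 >= |a|^2 and divide by t. *)
have Ct t : 0 < t <= 1 -> 2 * C <= t * B.
  move=> t01.
  have toc : (l2_sqnorm (a \- (fun k => t * b k))%R < +oo)%E by exact/l2B/l2Z.
  have := fine_le (l2_fin_num aoo) (l2_fin_num toc) (amin t t01).
  have -> : fine (l2_sqnorm (a \- (fun k => t * b k))%R) = A - 2 * t * C + t ^+ 2 * B.
    apply: (cvg_unique _ (l2_cvg toc)) => //.
    rewrite (_ : (fun n => _) = fun n => sumZ n (fun k => a k ^+ 2)
      - 2 * t * sumZ n (fun k => a k * b k) + t ^+ 2 * sumZ n (fun k => b k ^+ 2)).
      by apply: cvgD; [apply: cvgB => //|]; apply: cvgM => //; exact: cvg_cst.
    apply/funext => n; rewrite -mulNr -!sumZM -!sumZD; apply: eq_sumZ => k /=; ring.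
  by rewrite -/A; have /andP[t0 _] := t01; nra.
have B0 : 0 <= B by rewrite fine_ge0// esum_ge0// => k _; rewrite lee_fin sqr_ge0.
(* Instead of letting t tend to 0, a positive C is refuted at one t: t = 1 if B <= C, and t = C / B
   otherwise; either way 2C <= C. *)
have C0 : C <= 0.
  rewrite leNgt; apply/negP => C0.
  have [BC|BC] := leP B C; first by have := Ct 1; rewrite ltr01 lexx => /(_ isT); lra.
  have B1 : 0 < B := lt_trans C0 BC.
  have := Ct (C / B).
  rewrite divr_gt0//= ler_pdivrMr// mul1r ltW// => /(_ isT).
  by rewrite divfK ?gt_eqF//; lra.
rewrite -[leLHS]fineK ?lee_fin ?l2_fin_num//.
apply: (@le_trans _ _ (E + C)); last by lra.
apply: (ler_cvg_to bc (cvgD (cvg_cst _) abc)).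
apply: nearW => n; rewrite -lerBlDr (le_trans _ (bE n))// -mulN1r -sumZM -sumZD.
by apply: le_sumZ => k /=; nra.
Qed.

(** The lags i and -(i + 1) are paired, and rho^(i+1) <= rho^i, so the sum is at most twice a
    geometric series. *)
Lemma sumZ_geometric n rho : 0 <= rho < 1 ->
  sumZ n (fun k => rho ^+ `|k|%N) <= 2 / (1 - rho).
Proof.
move=> /andP[r0 r1].
apply: (@le_trans _ _ (2 * series (geometric 1 rho) n)).
  rewrite /series /= big_distrr; apply: ler_sum => i _ /=.
  by rewrite exprS mul1r; have := exprn_ge0 i r0; nra.
rewrite geometric_seriesE ?lt_eqF//= mul1r ler_pM2l//.
by rewrite ler_pdivrMr ?mulVf ?gt_eqF ?subr_gt0// gerBl exprn_ge0.
Qed.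

(** Dominated convergence, uniform in the window: past some [N] the weights have small mass and [D]
    is bounded, while the sum up to [N] is finite and tends to 0 termwise. *)
Lemma cvg_sumZ_weighted (D : nat -> int -> R) w C W :
  (forall k, 0 <= w k) -> (forall n, sumZ n w <= W) ->
  (forall M k, 0 <= D M k) -> (\forall M \near \oo, forall k, D M k <= C) ->
  (forall k, D M k @[M --> \oo] --> 0) ->
  forall e, 0 < e -> \forall M \near \oo, forall n, sumZ n (fun k => D M k * w k) <= e.
Proof.
move=> w0 wW D0 DC Dc e e0.
have wc : cvgn (sumZ ^~ w).
  apply: nondecreasing_is_cvgn; first exact: nondecreasing_sumZ.
  by exists W => _ [n _ <-].
have C0 : 0 <= C.
  near (\oo : set_system nat) => M; apply: (le_trans (D0 M 0)).
  by near: M; apply: filterS DC.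
(* [C] may be 0, so the tail tolerance is divided by [C + 1]. *)
have C1 : 0 < C + 1 by lra.
have [N wN] : exists N, limn (sumZ ^~ w) - e / 2 / (C + 1) <= sumZ N w.
  near (\oo : set_system nat) => N; exists N; near: N.
  apply: (cvgr_ge _ wc); rewrite gtrBl; by rewrite !divr_gt0.
have tail n : sumZ n w <= sumZ N w + e / 2 / (C + 1).
  rewrite -lerBlDr (le_trans _ wN)// lerD2r.
  by apply: nondecreasing_cvgn_le => //; exact: nondecreasing_sumZ.
have headc : sumZ N (fun k => D M k * w k) @[M --> \oo] --> 0.
  rewrite (_ : 0 = sumZ N (fun k => 0 * w k)); last first.
    by rewrite /sumZ big1// => i _; rewrite !mul0r addr0.
  by apply: cvg_sumZ => k; apply: cvgM; [exact: Dc|exact: cvg_cst].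
near=> M => n.
have DM : forall k, D M k <= C by near: M.
have hM : sumZ N (fun k => D M k * w k) <= e / 2.
  by near: M; apply: (cvgr_le _ headc); rewrite divr_gt0.
have [nN|Nn] := leP n N.
  rewrite (le_trans (nondecreasing_sumZ _ nN))//; last by lra.
  by move=> k; rewrite mulr_ge0.
have : sumZ n (fun k => D M k * w k) - sumZ N (fun k => D M k * w k)
    <= C * (sumZ n w - sumZ N w).
  rewrite /sumZ (@big_cat_nat _ _ _ N 0 n)//= ?(ltnW Nn)//.
  rewrite [in leRHS](@big_cat_nat _ _ _ N 0 n)//= ?(ltnW Nn)//.
  rewrite ![_ + \sum_(N <= _ < _) _]addrC !addrK big_distrr/=.
  by apply: ler_sum => i _; rewrite mulrDr lerD// ler_wpM2r.
have : C * (sumZ n w - sumZ N w) <= (C + 1) * (e / 2 / (C + 1)).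
  apply: ler_pM => //; last by have := tail n; lra.
  - by rewrite subr_ge0 nondecreasing_sumZ// ltnW.
  - by lra.
by rewrite mulrCA divff ?gt_eqF// mulr1; lra.
Unshelve. all: end_near.
Qed.

End int_sums.

(** * Integrals of almost everywhere bounded functions and against scaled measures *)

Section ae_bounded.
Set Implicit Arguments.
Unset Strict Implicit.
Context d (T : measurableType d) (R : realType).
Variables (mu : {measure set T -> \bar R}) (f : T -> R) (C : R).
Hypotheses (mufin : (mu setT < +oo)%E) (mf : measurable_fun setT f).
Hypotheses (C0 : 0 <= C) (fC : {ae mu, forall x, `|f x| <= C}).

Let abs_le : (\int[mu]_x `|(f x)%:E| <= C%:E * mu setT)%E.
Proof.
apply: integral_le_bound => //; first exact/measurable_EFinP.
by apply: filterS fC => x fx _ /=; rewrite lee_fin.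
Qed.

Lemma ae_bounded_integrable : mu.-integrable setT (EFin \o f).
Proof.
apply/integrableP; split; first exact/measurable_EFinP.
by apply: le_lt_trans abs_le _; rewrite lte_mul_pinfty.
Qed.

Lemma ae_bounded_Rintegral : `|\int[mu]_x f x| <= C * fine (mu setT).
Proof.
rewrite -lee_fin EFinM fineK ?ge0_fin_numE//; apply: le_trans abs_le.
rewrite /Rintegral -fine_abse ?integrable_fin_num//; last exact: ae_bounded_integrable.
rewrite fineK ?abse_fin_num ?integrable_fin_num//; last exact: ae_bounded_integrable.
apply: le_abse_integral => //; exact/measurable_EFinP.
Qed.

End ae_bounded.

Section mscale.
Context d (T : measurableType d) (R : realType).
Variables (mu : {measure set T -> \bar R}) (f : T -> \bar R) (k : {nonneg R}).

Lemma integrable_mscale : mu.-integrable setT f -> (mscale k mu).-integrable setT f.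
Proof.
move=> /integrableP[mf foo]; apply/integrableP; split => //.
rewrite ge0_integral_mscale//; last exact: measurableT_comp.
by rewrite lte_mul_pinfty.
Qed.

(** Odd powers change sign, so scaling is needed beyond nonnegative functions; it follows from the
    positive and negative parts. *)
Lemma integral_mscale : mu.-integrable setT f ->
  (\int[mscale k mu]_x f x = k%:num%:E * \int[mu]_x f x)%E.
Proof.
move=> fi; have mf := measurable_int _ fi.
rewrite [LHS]integralE ge0_integral_mscale//; last exact: measurable_funepos.
rewrite ge0_integral_mscale//; last exact: measurable_funeneg.
by rewrite -muleBr ?integrable_add_def// -integralE.
Qed.

End mscale.

Lemma measure_add_mscale d (T : measurableType d) (R : realType)
    (mu nu : {measure set T -> \bar R}) (s t : {nonneg R}) A :
  (measure_add (mscale s mu) (mscale t nu) A = s%:num%:E * mu A + t%:num%:E * nu A)%E.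
Proof. by rewrite measure_addE. Qed.

(** * Moments of measures carried by [-1 + delta, 1 - delta] *)

Section representing_measure.
Set Implicit Arguments.
Unset Strict Implicit.
Context {R : realType}.
Variables (delta : R) (delta01 : 0 < delta <= 1).
Implicit Types (m r : int -> R) (mu nu : {measure set R -> \bar R}) (f : R -> R).

Notation S := (moment_support delta).

Lemma measurable_moment_support : measurable S.
Proof. exact: measurable_itv. Qed.

Lemma moment_support_le x : S x -> `|x| <= 1 - delta.
Proof. by rewrite /moment_support/= in_itv/= ler_norml opprB addrC. Qed.

Lemma representing_measure_mass (A : set R) mu m :
  representing_measure A mu m -> mu setT = (m 0)%:E.
Proof.
by move=> [_ /(_ 0)] <-; rewrite -[LHS]mul1e -integral_cst//.
Qed.

Lemma representing_measure_ge0 (A : set R) mu m :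
  representing_measure A mu m -> 0 <= m 0.
Proof. by move=> /representing_measure_mass mu0; rewrite -lee_fin -mu0. Qed.

Lemma ae_moment_support mu f (C : R) : mu (~` S) = 0%E ->
  (forall x, `|x| <= 1 - delta -> `|f x| <= C) -> {ae mu, forall x, `|f x| <= C}.
Proof.
move=> mu0 fC; exists (~` S); split => //.
  by apply: measurableC; exact: measurable_moment_support.
by move=> x /= + Sx; apply; apply/fC/moment_support_le.
Qed.

Variables (mu : {measure set R -> \bar R}) (m : int -> R).
Hypothesis mum : representing_measure S mu m.

Let mu_fin : (mu setT < +oo)%E.
Proof. by rewrite (representing_measure_mass mum) ltry. Qed.

Lemma representing_measure_integrable f (C : R) : measurable_fun setT f -> 0 <= C ->
  (forall x, `|x| <= 1 - delta -> `|f x| <= C) -> mu.-integrable setT (EFin \o f).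
Proof.
move=> mf C0 fC; apply: (@ae_bounded_integrable _ _ _ _ _ C) => //.
exact: ae_moment_support mum.1 fC.
Qed.

Lemma representing_measure_Rintegral f (C : R) : measurable_fun setT f -> 0 <= C ->
  (forall x, `|x| <= 1 - delta -> `|f x| <= C) -> `|\int[mu]_x f x| <= C * m 0.
Proof.
move=> mf C0 fC; rewrite -[m 0]/(fine (m 0)%:E) -(representing_measure_mass mum).
by apply: ae_bounded_Rintegral => //; exact: ae_moment_support mum.1 fC.
Qed.

Let exp_bound n (x : R) : `|x| <= 1 - delta -> `|x ^+ n| <= (1 - delta) ^+ n.
Proof.
move=> xd; rewrite normrX lerXn2r ?nnegrE//.
by case/andP: delta01 => _; rewrite subr_ge0.
Qed.

Let delta0 n : 0 <= (1 - delta) ^+ n.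
Proof. by apply: exprn_ge0; rewrite subr_ge0; case/andP: delta01. Qed.

Lemma moment_integrable n : mu.-integrable setT (fun x => (x ^+ n)%:E).
Proof. exact: (representing_measure_integrable _ (delta0 n) (@exp_bound n)). Qed.

Lemma moment_Rintegral (k : int) : m k = \int[mu]_x (x ^+ `|k|%N).
Proof. by rewrite /Rintegral mum.2. Qed.

(** On the support |x^k| <= (1 - delta)^k, and the total mass is [m 0]. *)
Lemma moment_le (k : int) : `|m k| <= (1 - delta) ^+ `|k|%N * m 0.
Proof.
rewrite moment_Rintegral; apply: representing_measure_Rintegral => //.
exact: exp_bound.
Qed.

Lemma moment_horner (p : {poly R}) :
  \int[mu]_x p.[x] = \sum_(i < size p) p`_i * m i%:Z.
Proof.
rewrite /Rintegral; under eq_integral do rewrite horner_coef -sumEFin.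
rewrite integral_sum//=; last first.
  move=> i; under eq_fun do rewrite EFinM.
  by apply: integrableZl => //; exact: moment_integrable.
rewrite (eq_bigr (fun i : 'I__ => (p`_i * m i%:Z)%:E)) ?sumEFin// => i _.
under eq_integral do rewrite EFinM.
by rewrite integralZl//; [rewrite (mum.2 i%:Z) EFinM|exact: moment_integrable].
Qed.

End representing_measure.

(** * Convergence of moments: vague limits and projections *)

Section moment_convergence.
Context {R : realType} (delta : R) (delta01 : 0 < delta <= 1).

Lemma moment_sequence_convex m1 m2 (s t : {nonneg R}) :
  moment_sequence delta m1 -> moment_sequence delta m2 ->
  moment_sequence delta (fun k => s%:num * m1 k + t%:num * m2 k).
Proof.
move=> [mu1 rep1] [mu2 rep2].
exists (measure_add (mscale s mu1) (mscale t mu2)); split.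
  by apply: (etrans (measure_add_mscale _ _ _ _ _)); rewrite rep1.1 rep2.1 !mule0 adde0.
move=> k.
have i1 := moment_integrable delta01 rep1 `|k|%N.
have i2 := moment_integrable delta01 rep2 `|k|%N.
rewrite integral_measure_add//; try exact: integrable_mscale.
by rewrite !integral_mscale// rep1.2 rep2.2.
Qed.

Lemma moment_l2 m : moment_sequence delta m -> (l2_sqnorm m < +oo)%E.
Proof.
move=> [mu rep]; have m0 := representing_measure_ge0 rep.
have [dp d1] := andP delta01.
have d01 : 0 <= 1 - delta < 1 by apply/andP; lra.
apply: (@le_lt_trans _ _ (m 0 ^+ 2 * (2 / (1 - (1 - delta))))%:E); last exact: ltry.
apply: l2_le => n.
apply: (@le_trans _ _ (m 0 ^+ 2 * sumZ n (fun k => (1 - delta) ^+ `|k|%N))).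
  rewrite -sumZM; apply: le_sumZ => k.
  have r0 : 0 <= (1 - delta) ^+ `|k|%N by apply: exprn_ge0; case/andP: d01.
  have r1 : (1 - delta) ^+ `|k|%N <= 1 by apply: exprn_ile1; lra.
  rewrite -[leLHS]real_normK ?num_real//.
  apply: (@le_trans _ _ (((1 - delta) ^+ `|k|%N * m 0) ^+ 2)).
    by rewrite lerXn2r ?nnegrE ?mulr_ge0//; exact: (moment_le delta01 rep).
  by rewrite exprMn mulrC ler_wpM2l ?sqr_ge0// expr2 ler_piMl.
by rewrite ler_wpM2l ?sqr_ge0//; exact: sumZ_geometric.
Qed.

(** Replacing [f] by a polynomial costs at most the uniform error times the mass; the masses are
    zeroth moments, so they converge and stay bounded. *)
Lemma vague_cvg_moments (mu_ : nat -> {measure set R -> \bar R}) m_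
    (nu : {measure set R -> \bar R}) m :
  (forall n, representing_measure (moment_support delta) (mu_ n) (m_ n)) ->
  representing_measure (moment_support delta) nu m ->
  (forall k : nat, m_ n k%:Z @[n --> \oo] --> m k%:Z) ->
  vague_cvg mu_ nu.
Proof.
move=> mum num mc f cf _ _; have [dp d1] := andP delta01.
(* Approximation takes place on [-1, 1]: the support interval is a single point when delta = 1,
   whereas [weierstrass] asks for [a < b]. *)
have S1 x : `|x| <= 1 - delta -> -1 <= x <= 1.
  by move=> xd; rewrite -ler_norml (le_trans xd)//; lra.
have inte h mu' m' : continuous h ->
    representing_measure (moment_support delta) mu' m' ->
    mu'.-integrable setT (EFin \o h).
  move=> ch rep; have [B B0 hB] := @segment_bounded _ h (-1) 1 ch.
  apply: (representing_measure_integrable rep _ B0).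
    exact: continuous_measurable_fun.
  by move=> x /S1; exact: hB.
have approx e : 0 < e -> exists p : {poly R}, forall mu' m',
    representing_measure (moment_support delta) mu' m' ->
    `|\int[mu']_x f x - \int[mu']_x p.[x]| <= e * m' 0.
  move=> e0; have [p pP] := @weierstrass R f (-1) 1 e ltac:(lra) cf e0.
  exists p => mu' m' rep.
  have cp := @continuous_horner _ p.
  rewrite -RintegralB//; try exact: inte rep.
  apply: (representing_measure_Rintegral rep) => [||x /S1/pP//]; last exact: ltW.
  by apply: measurable_funB; exact: continuous_measurable_fun.
have int_fin mu' m' : representing_measure (moment_support delta) mu' m' ->
    (\int[mu']_x (f x)%:E)%E = (\int[mu']_x f x)%:E.
  by move=> rep; rewrite fineK// integrable_fin_num//; exact: inte rep.
rewrite (int_fin _ _ num); under eq_fun do rewrite (int_fin _ _ (mum _)).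
apply: cvg_EFin; first by apply: nearW.
rewrite [X in X @ _ --> _](_ : _ = fun n => \int[mu_ n]_x f x)//.
apply/cvgrPdist_le => e e0.
have m0 := representing_measure_ge0 num.
(* This bounds the sum of the two masses once [m_ n 0 <= m 0 + 1]. *)
have c0 : 0 < 2 * m 0 + 1 by lra.
have [p pP] := approx (e / 2 / (2 * m 0 + 1)) ltac:(by rewrite !divr_gt0).
have pc : \int[mu_ n]_x p.[x] @[n --> \oo] --> \int[nu]_x p.[x].
  rewrite (moment_horner delta01 num).
  under eq_fun do rewrite (moment_horner delta01 (mum _)).
  have := @cvg_big R 'I_(size p) +%R 0 predT (@add_continuous R^o) _
    (\oo : set_system nat) (index_enum _)
    (fun i n => p`_i * m_ n i%:Z) (fun i => p`_i * m i%:Z).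
  apply=> i _.
  by apply: cvgM; [exact: cvg_cst|exact: mc].
near=> n.
have h1 := pP _ _ num; have h2 := pP _ _ (mum n).
have h3 : `|\int[nu]_x p.[x] - \int[mu_ n]_x p.[x]| <= e / 2.
  by near: n; move/cvgrPdist_le : pc; apply; rewrite divr_gt0.
have h4 : m_ n 0 <= m 0 + 1.
  by near: n; apply: (cvgr_le _ (mc 0%N)); rewrite ltrDl.
have h5 : e / 2 / (2 * m 0 + 1) * (m 0 + m_ n 0) <= e / 2.
  by rewrite mulrAC ler_pdivrMr// ler_pM2l ?divr_gt0//; lra.
rewrite (_ : _ - _ = (\int[nu]_x f x - \int[nu]_x p.[x]) +
  (\int[nu]_x p.[x] - \int[mu_ n]_x p.[x]) -
  (\int[mu_ n]_x f x - \int[mu_ n]_x p.[x])); last by ring.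
rewrite (le_trans (ler_normB _ _))// (le_trans (lerD (ler_normD _ _) (lexx _)))//.
by lra.
Unshelve. all: end_near.
Qed.

Lemma projection_cvg (F : {measure set R -> \bar R}) (gamma : int -> R)
    (r m_ : nat -> int -> R) :
  representing_measure (moment_support delta) F gamma ->
  (forall M, (l2_sqnorm (r M) < +oo)%E) ->
  (forall M k, `|r M k| <= r M 0) ->
  (forall M, is_moment_projection delta (r M) (m_ M)) ->
  (forall k, r M k @[M --> \oo] --> gamma k) ->
  forall k, m_ M k @[M --> \oo] --> gamma k.
Proof.
move=> rep r2 r0 proj rc k.
have g0 := representing_measure_ge0 rep.
have [dp d1] := andP delta01.
have d01 : 0 <= 1 - delta < 1 by apply/andP; lra.
have Fm : moment_sequence delta gamma by exists F.
have small e : 0 < e -> \forall M \near \oo, forall n,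
    sumZ n (fun k => `|r M k - gamma k| * (1 - delta) ^+ `|k|%N) <= e.
  (* Eventually |r_M(k)| <= r_M(0) <= gamma(0) + 1, and |gamma(k)| <= gamma(0). *)
  apply: (@cvg_sumZ_weighted _ _ _ (gamma 0 + 1 + gamma 0) (2 / (1 - (1 - delta)))).
  - by move=> j; apply: exprn_ge0; lra.
  - by move=> n; exact: sumZ_geometric.
  - by [].
  - near=> M => j; rewrite (le_trans (ler_normB _ _))// lerD//.
      rewrite (le_trans (r0 _ _))//.
      by near: M; apply: (cvgr_le _ (rc 0)); rewrite ltrDl.
    rewrite (le_trans (moment_le delta01 rep j))// ler_piMl//.
    by apply: exprn_ile1; lra.
  - move=> j; rewrite -[0](@normr0 _ R) -(subrr (gamma j)).
    by apply: cvg_norm; apply: cvgB; [exact: rc|exact: cvg_cst].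
have bound M e : (forall n,
    sumZ n (fun k => `|r M k - gamma k| * (1 - delta) ^+ `|k|%N) <= e) ->
    forall j, (gamma j - m_ M j) ^+ 2 <= (gamma 0 + m_ M 0) * e.
  move=> sume j; have [mM m2 mmin] := proj M; have [mu mu_rep] := mM.
  have m0 := representing_measure_ge0 mu_rep.
  rewrite -lee_fin; apply: le_trans (sqr_le_l2 (gamma \- m_ M) j) _.
  apply: (@l2_first_order _ (r M \- m_ M)).
  - exact: l2B.
  - by apply: l2B => //; exact: moment_l2.
  - move=> t /andP[t0 t1].
    have t1' : 0 <= 1 - t by lra.
    (* The competitor on the segment from m_M to gamma: r - c = (r - m_M) - t (gamma - m_M). *)
    pose c k := (NngNum t1')%:num * m_ M k + (NngNum (ltW t0))%:num * gamma k.
    have cm : moment_sequence delta c by exact: moment_sequence_convex.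
    have := mmin c cm (moment_l2 cm).
    congr (_ <= l2_sqnorm _)%E; apply/funext => i; rewrite /c /=; ring.
  - move=> n; apply: le_trans (ler_wpM2l _ (sume n)); last exact: addr_ge0.
    rewrite -sumZM; apply: le_sumZ => i /=.
    rewrite (le_trans (ler_norm _))// normrM.
    rewrite (_ : _ - _ - _ = - (r M i - gamma i)) ?normrN; last by ring.
    rewrite mulrCA ler_wpM2l// (le_trans (ler_normB _ _))//.
    rewrite mulrDl lerD// mulrC; first exact: (moment_le delta01 rep).
    exact: (moment_le delta01 mu_rep).
apply/cvgrPdist_le => e e0.
have c0 : 0 < 1 + 4 * gamma 0 by lra.
(* The bound 1 serves to control m_M(0); the other one then turns gamma(0) + m_M(0) <= 1 + 4
   gamma(0) into a squared error of at most e^2. *)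
pose h := Num.min 1 (e ^+ 2 / (1 + 4 * gamma 0)).
have h0 : 0 < h by rewrite lt_min ltr01 divr_gt0// exprn_gt0.
have := small h h0; apply: filterS => M /bound b.
have m0 : 0 <= m_ M 0 by have [[mu /representing_measure_ge0]] := proj M.
have h1 : h <= 1 by rewrite ge_min lexx.
have h2 : (1 + 4 * gamma 0) * h <= e ^+ 2.
  by rewrite mulrC -ler_pdivlMr// ge_min lexx orbT.
have mb : m_ M 0 <= 1 + 3 * gamma 0.
  have b0 : (gamma 0 - m_ M 0) ^+ 2 <= gamma 0 + m_ M 0.
    by rewrite (le_trans (b 0))// ler_piMr// addr_ge0.
  (* For m_M(0) = 1 + 3 gamma(0) + s with s > 0, the square (1 + 2 gamma(0) + s)^2 exceeds 1 + 4
     gamma(0) + s. *)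
  rewrite leNgt; apply/negP => mgt; nra.
rewrite -(@ler_pXn2r _ 2)// ?nnegrE ?(ltW e0)// real_normK ?num_real//.
by rewrite (le_trans (b k))// (le_trans _ h2)// ler_wpM2r//; lra.
Unshelve. all: end_near.
Qed.
End moment_convergence.

(** * Almost sure vague convergence of the estimated measures *)

Theorem proposition10 (R : realType) (X : completeMetricType R)
  (sepX : separable X)
  (Q : R.-pker (borel X) ~> (borel X))
  (P : probability (borel X) R -> probability (path_space (borel X)) R)
  (chainP : forall nu : probability (borel X) R, is_chain_law Q nu (P nu))
  (psi : {sigma_finite_measure set (borel X) -> \bar R})
  (irrQ : psi_irreducible P psi)
  (aperQ : aperiodic Q psi)
  (harrisQ : positive_harris_recurrent Q P psi)
  (pi : probability (borel X) R)
  (revQ : reversible Q pi)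
  (ergQ : geometrically_ergodic Q pi)
  (g : borel X -> R)
  (mg : measurable_fun setT g)
  (g2 : (\int[pi]_x (g x ^+ 2)%:E < +oo)%E)
  (F : {measure set R -> \bar R})
  (F_gamma : representing_measure `[-1, 1] F (autocovariance P pi g))
  (delta : R)
  (delta01 : 0 < delta <= 1)
  (F_delta : F (~` moment_support delta) = 0%E)
  (r : forall M : nat, ('I_M -> borel X) -> int -> R)
  (R1 : consistent_estimator P (autocovariance P pi g) r)
  (R2 : finite_lag_estimator r)
  (R3 : symmetric_peaked_estimator r)
  (Pi_r : forall M : nat, ('I_M -> borel X) -> int -> R)
  (Pi_rP : forall M s, is_moment_projection delta (r M s) (Pi_r M s))
  (mu_hat : forall M : nat, ('I_M -> borel X) -> {measure set R -> \bar R})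
  (mu_hatP : forall M s,
     representing_measure (moment_support delta) (mu_hat M s) (Pi_r M s)) :
  forall x : borel X, {ae P \d_x, forall w : path_space (borel X),
    vague_cvg (fun M => mu_hat M (sample (M := M) w)) F}.
Proof.
move=> x.
(* A countable intersection over the lags n >= 0 suffices: negative lags follow from the symmetry of
   [r] and of the autocovariance. *)
have : {ae P \d_x, forall w : path_space (borel X), forall n : nat,
    r M (sample (M := M) w) n%:Z @[M --> \oo] --> autocovariance P pi g n%:Z}.
  by apply: ae_foralln => n; exact: R1.
apply: filterS => w rw.
have rep : representing_measure (moment_support delta) F (autocovariance P pi g).
  by split => //; exact: F_gamma.2.
have rc k : r M (sample (M := M) w) k @[M --> \oo] --> autocovariance P pi g k.
  case: k => n; first exact: rw.
  under eq_fun do rewrite NegzE -(R3 _ _ _).1.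
  exact: (rw n.+1).
have r2 M : (l2_sqnorm (r M (sample (M := M) w)) < +oo)%E.
  (* [R2] kills only large positive lags; symmetry carries this to [Negz n], whose absolute value is
     [n.+1]. *)
  have [N rN] := R2 M; apply: (@finite_lag_l2 _ _ N) => -[] n Nn; first exact: rN.
  by rewrite NegzE -(R3 _ _ _).1; exact: rN.
have mc := projection_cvg delta01 rep r2 (fun M j => (R3 M _ j).2)
  (fun M => Pi_rP M (sample (M := M) w)) rc.
apply: (vague_cvg_moments delta01 _ rep) => [M|k]; first exact: mu_hatP.
exact: mc.
Qed.
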